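(* Assume $\Lambda$ admits one-step wsi models, and fix for each conjunctive one-step $\Lambda$-formula $\psi$ over a finite set $V$ a one-step wsi model $(X_\psi,\tau_\psi,t_\psi)$ with $X_\psi\subseteq\mathcal P(V(\psi))$ and $\tau_\psi(p)=\{A\in X_\psi: p\in A\}$ for $p\in V(\psi)$, where $V(\psi)$ is the set of variables occurring in $\psi$. Let $\phi=\nu(x_0;x_1,\dots,x_n).(\phi_0;\phi_1,\dots,\phi_n)$ be a shallow conjunctive $\Lambda$-$\nu$-sentence, i.e. each $\phi_i$ is a conjunctive one-step $\Lambda$-formula over $V=\{x_0,\dots,x_n\}$ (a finite conjunction of atoms $\heartsuit x_j$, $\heartsuit\in\Lambda$). For $A\subseteq V$ let $\phi_A=\bigwedge_{x_i\in A}\phi_i$. Let $X_\phi$ be the smallest subset of $\mathcal P(V)$ containing $r_\phi=\{x_0\}$ such that $X_{\phi_A}\subseteq X_\phi$ for each $A\in X_\phi$, and define $\xi_\phi:X_\phi\to TX_\phi$ by $\xi_\phi(A)=T(i_A)(t_{\phi_A})$, where $i_A:X_{\phi_A}\hookrightarrow X_\phi$ is the inclusion. Then $((X_\phi,\xi_\phi),r_\phi)$ is a wsi model for $\phi$.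
   Context: Fix an endofunctor $T$ on sets, non-trivial ($TX=\emptyset\Rightarrow X=\emptyset$) and preserving subsets. $\Lambda$ is a set of modal operators $\heartsuit$ (unary; atomic propositions nullary), each with a monotone natural predicate lifting $[\![\heartsuit]\!]_X:\mathcal P(X)\to\mathcal P(TX)$ (naturality: $[\![\heartsuit]\!]_X(f^{-1}[A])=(Tf)^{-1}[[\![\heartsuit]\!]_Y(A)]$); $t\models\heartsuit A$ means $t\in[\![\heartsuit]\!]_X(A)$. Models are $T$-coalgebras $(X,\xi)$. A $\Lambda$-simulation of $C=(X,\xi)$ by $D=(Y,\zeta)$ is $S\subseteq X\times Y$ with: $xSy$ and $\xi(x)\models\heartsuit A$ imply $\zeta(y)\models\heartsuit S[A]$. Fixpoint formulas: over a set $\Delta$ of fixpoint variables, positive $\Lambda$-$\nu$-formulas are built from $\top,\bot,\wedge,\vee,\heartsuit$, variables and $\alpha(y_0;y_1,\dots,y_n).(\phi_0;\dots,\phi_n)$ ($\alpha\in\{\nu,\mu\}$, distinct $y_i$); conjunctive $\Lambda$-$\nu$-formulas use only $\top,\wedge,\heartsuit$, variables and $\nu$; a sentence has no free fixpoint variables. $[\![\nu(y_0;\dots,y_n).(\phi_0;\dots,\phi_n)]\!]_{C,\mathcal V}$ is the first component of the greatest fixpoint of $(A_0,\dots,A_n)\mapsto([\![\phi_i]\!]_{C,\mathcal V[y_0\mapsto A_0,\dots,y_n\mapsto A_n]})_{i=0..n}$ ($\mu$ dually), variables are interpreted by $\mathcal V$, and $x\in[\![\heartsuit\phi]\!]$ iff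 $\xi(x)\models\heartsuit[\![\phi]\!]$. A pointed model $(C_\phi,r)$ is wsi for a sentence $\phi$ if for every pointed model $(D,y)$: $y\models_D\phi$ iff $rSy$ for some $\Lambda$-simulation $S$ of $C_\phi$ by $D$. One-step notions: a one-step model over $V$ is $(X,\tau,t)$, $\tau:V\to\mathcal P(X)$, $t\in TX$, $\breve\tau(x)=\{p:x\in\tau(p)\}$; $(X,\tau,t)\models\bigwedge\heartsuit_ip_i$ iff $t\models\heartsuit_i\tau(p_i)$ for all $i$. $(X,\tau,t)$ is one-step wsi for a conjunctive one-step formula $\psi$ if it satisfies $\psi$ and for every one-step model $(Y,\theta,s)\models\psi$, $A\subseteq X$, $\heartsuit\in\Lambda$: $t\models\heartsuit A$ implies $s\models\heartsuit S[A]$, where $xSy$ iff $\breve\tau(x)\subseteq\breve\theta(y)$. $\Lambda$ admits one-step wsi models if every conjunctive one-step formula has one. *)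

(* Defs.v *)
From HB Require Import structures.
From mathcomp Require Import all_boot.
From mathcomp Require Import finmap.
From mathcomp Require Import boolp classical_sets.

Set Implicit Arguments.
Unset Strict Implicit.
Unset Printing Implicit Defensive.

Local Open Scope classical_set_scope.

(* [set X] is the classical powerset X -> Prop; [{set V}] is the type of subsets
   of a finite type V. *)

Record set_functor := SetFunctor {
  fobj :> Type -> Type;
  fmap : forall X Y : Type, (X -> Y) -> fobj X -> fobj Y;
  fmap_id : forall (X : Type) (t : fobj X), fmap id t = t;
  fmap_comp : forall (X Y Z : Type) (f : X -> Y) (g : Y -> Z) (t : fobj X),
    fmap (g \o f) t = fmap g (fmap f t)
}.

Arguments fmap s {X Y} _ _.

Definition nontrivial (T : set_functor) : Prop :=
  forall X : Type, (T X -> False) -> X -> False.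

(* A subset A of Y is the type {y | A y} with its projection to Y, so that
   "T A is a subset of T Y" means that T maps this projection to an injection. *)
Definition preserves_subsets (T : set_functor) : Prop :=
  forall (Y : Type) (A : set Y), injective (fmap T (fun u : {y | A y} => sval u)).

(* The set of modal operators, split by arity: [op1] are the unary operators and
   [op0] the nullary ones (atomic propositions). *)
Record modal_sig (T : set_functor) := ModalSig {
  op1 : Type;
  op0 : Type;
  plift1 : op1 -> forall X : Type, set X -> set (T X);
  plift0 : op0 -> forall X : Type, set (T X);
  plift1_mono : forall (h : op1) (X : Type) (A B : set X),
    A `<=` B -> plift1 h A `<=` plift1 h B;
  plift1_nat : forall (h : op1) (X Y : Type) (f : X -> Y) (A : set Y),
    plift1 h (f @^-1` A) = fmap T f @^-1` plift1 h A;
  plift0_nat : forall (a : op0) (X Y : Type) (f : X -> Y),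
    @plift0 a X = fmap T f @^-1` @plift0 a Y
}.

Arguments plift0 {T m} _ X _.

Record coalg (T : set_functor) := Coalg {
  carrier :> Type;
  trans : carrier -> T carrier
}.

Definition rel_image (X Y : Type) (S : X -> Y -> Prop) (A : set X) : set Y :=
  [set y | exists2 x, A x & S x y].

(* Transfer of all modal properties along S from t to s: the common part of the
   definitions of simulations and of one-step wsi models. *)
Definition transfers (T : set_functor) (L : modal_sig T) (X Y : Type)
    (S : X -> Y -> Prop) (t : T X) (s : T Y) : Prop :=
  (forall (h : op1 L) (A : set X), plift1 h A t -> plift1 h (rel_image S A) s) /\
  (forall a : op0 L, plift0 a X t -> plift0 a Y s).

Definition simulation (T : set_functor) (L : modal_sig T) (C D : coalg T)
    (S : C -> D -> Prop) : Prop :=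
  forall x y, S x y -> transfers L S (trans x) (trans y).

Inductive fixkind := Nu | Mu.

(* [FFix a y_inj phi] is a(y_0; y_1, ..., y_n).(phi_0; phi_1, ..., phi_n). *)
Inductive form (T : set_functor) (L : modal_sig T) (Delta : choiceType) : Type :=
| FTop
| FBot
| FAnd of form L Delta & form L Delta
| FOr of form L Delta & form L Delta
| FProp of op0 L
| FBox of op1 L & form L Delta
| FVar of Delta
| FFix (a : fixkind) (n : nat) (y : 'I_n.+1 -> Delta) (y_inj : injective y)
    (phi : 'I_n.+1 -> form L Delta).

Arguments FTop {T L Delta}.
Arguments FBot {T L Delta}.
Arguments FProp {T L Delta} a.
Arguments FVar {T L Delta} v.
Arguments FFix {T L Delta} a {n y} y_inj phi.

Fixpoint conjunctive (T : set_functor) (L : modal_sig T) (Delta : choiceType)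
    (phi : form L Delta) : Prop :=
  match phi with
  | FTop | FProp _ | FVar _ => True
  | FBot | FOr _ _ => False
  | FAnd p q => conjunctive p /\ conjunctive q
  | FBox _ p => conjunctive p
  | FFix a _ _ _ p => a = Nu /\ forall i, conjunctive (p i)
  end.

Fixpoint free_vars (T : set_functor) (L : modal_sig T) (Delta : choiceType)
    (phi : form L Delta) : set Delta :=
  match phi with
  | FTop | FBot | FProp _ => set0
  | FAnd p q | FOr p q => free_vars p `|` free_vars q
  | FBox _ p => free_vars p
  | FVar v => [set v]
  | FFix _ _ y _ p => [set v | (exists i, free_vars (p i) v) /\ forall i, y i <> v]
  end.

Definition sentence (T : set_functor) (L : modal_sig T) (Delta : choiceType)
    (phi : form L Delta) : Prop := free_vars phi = set0.

(* V[y_0 |-> A_0, ..., y_n |-> A_n] *)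
Definition update (Delta : choiceType) (X : Type) (V : Delta -> set X) (n : nat)
    (y : 'I_n -> Delta) (A : 'I_n -> set X) : Delta -> set X :=
  fun v => if [pick i | y i == v] is Some i then A i else V v.

(* Knaster-Tarski; see [gfp_fix], [gfp_max], [lfp_fix], [lfp_min] below. *)
Definition gfp (I X : Type) (F : (I -> set X) -> I -> set X) : I -> set X :=
  fun i => [set x | exists2 B : I -> set X, (forall j, B j `<=` F B j) & B i x].

Definition lfp (I X : Type) (F : (I -> set X) -> I -> set X) : I -> set X :=
  fun i => [set x | forall B : I -> set X, (forall j, F B j `<=` B j) -> B i x].

Fixpoint sem (T : set_functor) (L : modal_sig T) (Delta : choiceType)
    (C : coalg T) (V : Delta -> set C) (phi : form L Delta) : set C :=
  match phi with
  | FTop => setT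
  | FBot => set0
  | FAnd p q => sem V p `&` sem V q
  | FOr p q => sem V p `|` sem V q
  | FProp a => [set x | plift0 a C (trans x)]
  | FBox h p => [set x | plift1 h (sem V p) (trans x)]
  | FVar v => V v
  | FFix Nu _ y _ p => gfp (fun A i => sem (update V y A) (p i)) ord0
  | FFix Mu _ y _ p => lfp (fun A i => sem (update V y A) (p i)) ord0
  end.

(* Meant for sentences, where the valuation is irrelevant ([sat_sentence]). *)
Definition sat (T : set_functor) (L : modal_sig T) (Delta : choiceType)
    (C : coalg T) (x : C) (phi : form L Delta) : Prop :=
  sem (fun _ => set0) phi x.

Definition wsi (T : set_functor) (L : modal_sig T) (Delta : choiceType)
    (phi : form L Delta) (C : coalg T) (r : C) : Prop :=
  forall (D : coalg T) (y : D),
    sat y phi <-> exists2 S : C -> D -> Prop, simulation L S & S r y.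

Arguments wsi {T L Delta} phi C r.

(* A conjunctive one-step formula is the list of its conjuncts; [::] is the
   empty conjunction. *)
Inductive osatom (T : set_functor) (L : modal_sig T) (V : Type) : Type :=
| ABox of op1 L & V
| AProp of op0 L.

Arguments AProp {T L V} a.

Definition osform (T : set_functor) (L : modal_sig T) (V : Type) : Type :=
  seq (osatom L V).

Fixpoint osvars (T : set_functor) (L : modal_sig T) (V : finType)
    (psi : osform L V) : {set V} :=
  match psi with
  | [::] => finset.set0
  | ABox _ p :: psi' => p |: osvars psi'
  | AProp _ :: psi' => osvars psi'
  end.

Record osmodel (T : set_functor) (V : Type) := OSModel {
  os_carrier : Type;
  os_val : V -> set os_carrier;
  os_elt : T os_carrier
}.

Arguments os_val {T V} o _ _.

Definition ossat_atom (T : set_functor) (L : modal_sig T) (V : Type)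
    (M : osmodel T V) (a : osatom L V) : Prop :=
  match a with
  | ABox h p => plift1 h (os_val M p) (os_elt M)
  | AProp a => plift0 a (os_carrier M) (os_elt M)
  end.

Fixpoint ossat (T : set_functor) (L : modal_sig T) (V : Type)
    (M : osmodel T V) (psi : osform L V) : Prop :=
  if psi is a :: psi' then ossat_atom M a /\ ossat M psi' else True.

Definition os_theory (T : set_functor) (V : Type) (M : osmodel T V)
    (x : os_carrier M) : set V := [set p | os_val M p x].

Definition os_wsi (T : set_functor) (L : modal_sig T) (V : Type)
    (psi : osform L V) (M : osmodel T V) : Prop :=
  ossat M psi /\
  forall N : osmodel T V, ossat N psi ->
    transfers L (fun (x : os_carrier M) (y : os_carrier N) =>
                   os_theory x `<=` os_theory y)
              (os_elt M) (os_elt N).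

Definition admits_os_wsi (T : set_functor) (L : modal_sig T) : Prop :=
  forall (V : finType) (psi : osform L V), exists M : osmodel T V, os_wsi psi M.

Notation elems Y := {A : {set _} | A \in Y}.

(* A one-step wsi model of psi whose carrier is a set of subsets of V(psi); the
   valuation is left unspecified on the variables that do not occur in psi. *)
Record set_os_wsi (T : set_functor) (L : modal_sig T) (V : finType)
    (psi : osform L V) := SetOSWsi {
  sw_set : {set {set V}};
  sw_val : V -> set (elems sw_set);
  sw_elt : T (elems sw_set);
  sw_sub : sw_set \subset powerset (osvars psi);
  sw_valE : forall p : V, p \in osvars psi ->
    sw_val p = [set A : elems sw_set | p \in sval A];
  sw_wsi : os_wsi psi (OSModel sw_val sw_elt)
}.

Definition form_of_atom (T : set_functor) (L : modal_sig T) (Delta : choiceType)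
    (V : {fset Delta}) (a : osatom L V) : form L Delta :=
  match a with
  | ABox h p => FBox h (FVar (val p))
  | AProp a => FProp a
  end.

Fixpoint form_of_os (T : set_functor) (L : modal_sig T) (Delta : choiceType)
    (V : {fset Delta}) (psi : osform L V) : form L Delta :=
  if psi is a :: psi' then FAnd (form_of_atom a) (form_of_os psi') else FTop.

Lemma fset_enum_inj (Delta : choiceType) (V : {fset Delta}) (n : nat)
  (x : 'I_n.+1 -> V) : bijective x -> injective (fun i => val (x i)).
Proof. by move=> /bij_inj xI i j /val_inj /xI. Qed.

(* nu(x_0; x_1, ..., x_n).(phi_0; phi_1, ..., phi_n), where x enumerates V
   without repetition. *)
Definition shallow_nu (T : set_functor) (L : modal_sig T) (Delta : choiceType)
    (V : {fset Delta}) (n : nat) (x : 'I_n.+1 -> V) (x_bij : bijective x)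
    (phi : 'I_n.+1 -> osform L V) : form L Delta :=
  FFix Nu (fset_enum_inj x_bij) (fun i => form_of_os (phi i)).

Section CanonicalModel.
Context (T : set_functor) (L : modal_sig T).
Context (M : forall (V : finType) (psi : osform L V), set_os_wsi psi).
Context (V : finType) (n : nat) (x : 'I_n.+1 -> V) (phi : 'I_n.+1 -> osform L V).

Definition phi_at (A : {set V}) : osform L V :=
  flatten [seq phi i | i <- enum 'I_n.+1 & x i \in A].

Definition Xphi_closed (Y : {set {set V}}) : bool :=
  ([set x ord0]%SET \in Y) &&
  [forall A in Y, sw_set (M (phi_at A)) \subset Y].

Definition Xphi : {set {set V}} :=
  (\bigcap_(Y : {set {set V}} | Xphi_closed Y) Y)%SET.

Lemma Xphi_root : [set x ord0]%SET \in Xphi.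
Proof. by apply/finset.bigcapP => Y /andP[]. Qed.

Lemma Xphi_step (A : {set V}) (B : {set V}) :
  A \in Xphi -> B \in sw_set (M (phi_at A)) -> B \in Xphi.
Proof.
move=> /finset.bigcapP AX BA; apply/finset.bigcapP => Y cY.
have /andP[_ /forall_inP/(_ A (AX Y cY))/fintype.subsetP] := cY.
exact.
Qed.

Definition Xphi_incl (A : elems Xphi)
    (B : elems (sw_set (M (phi_at (sval A))))) :
    elems Xphi :=
  exist _ (sval B) (Xphi_step (svalP A) (svalP B)).

Definition canonical_model : coalg T :=
  @Coalg T (elems Xphi)
    (fun A => fmap T (@Xphi_incl A) (sw_elt (M (phi_at (sval A))))).

Definition canonical_root : canonical_model := exist _ [set x ord0]%SET Xphi_root.

End CanonicalModel.

Lemma gfp_fix (I X : Type) (F : (I -> set X) -> I -> set X) :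
  (forall A B, (forall j, A j `<=` B j) -> forall j, F A j `<=` F B j) ->
  F (gfp F) = gfp F.
Proof.
move=> Fmono.
have post j : gfp F j `<=` F (gfp F) j.
  move=> x [B BF Bx]; apply: (Fmono B) (BF j x Bx) => k z Bz; by exists B.
apply/funext => j; apply/seteqP; split; last exact: post.
by move=> x Fx; exists (F (gfp F)) => // k; apply: Fmono.
Qed.

Lemma gfp_max (I X : Type) (F : (I -> set X) -> I -> set X) (B : I -> set X) :
  F B = B -> forall j, B j `<=` gfp F j.
Proof. by move=> FB j x Bx; exists B => // k; rewrite FB. Qed.

Lemma lfp_fix (I X : Type) (F : (I -> set X) -> I -> set X) :
  (forall A B, (forall j, A j `<=` B j) -> forall j, F A j `<=` F B j) ->
  F (lfp F) = lfp F.
Proof.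
move=> Fmono.
have pre j : F (lfp F) j `<=` lfp F j.
  by move=> x Fx B BF; apply: (BF); apply: Fmono Fx => k z lz; apply: lz.
apply/funext => j; apply/seteqP; split; first exact: pre.
by move=> x; apply => k; apply: Fmono.
Qed.

Lemma lfp_min (I X : Type) (F : (I -> set X) -> I -> set X) (B : I -> set X) :
  F B = B -> forall j, lfp F j `<=` B j.
Proof. by move=> FB j x; apply=> k; rewrite FB. Qed.

Lemma update_mono (Delta : choiceType) (X : Type) (V W : Delta -> set X) (n : nat)
    (y : 'I_n -> Delta) (A B : 'I_n -> set X) :
  (forall v, V v `<=` W v) -> (forall i, A i `<=` B i) ->
  forall v, update V y A v `<=` update W y B v.
Proof. by move=> VW AB v; rewrite /update; case: pickP => *; auto. Qed.

Lemma sem_mono (T : set_functor) (L : modal_sig T) (Delta : choiceType)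
    (C : coalg T) (phi : form L Delta) (V W : Delta -> set C) :
  (forall v, V v `<=` W v) -> sem V phi `<=` sem W phi.
Proof.
elim: phi V W => [||p IHp q IHq|p IHp q IHq|b|h p IHp|v|a n y y_inj p IHp]
  V W VW //=.
- by apply: setISS; [apply: IHp|apply: IHq].
- by apply: setUSS; [apply: IHp|apply: IHq].
- by move=> x; apply: plift1_mono; apply: IHp.
have F_le A j : sem (update V y A) (p j) `<=` sem (update W y A) (p j).
  by apply: IHp; apply: update_mono => // i; exact: subset_refl.
case: a => x.
  by case=> B BF Bx; exists B => // j z /BF /F_le.
by move=> sx B BF; apply: sx => j z /F_le /BF.
Qed.

Lemma sem_free (T : set_functor) (L : modal_sig T) (Delta : choiceType)
    (C : coalg T) (phi : form L Delta) (V W : Delta -> set C) :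
  (forall v, free_vars phi v -> V v = W v) -> sem V phi = sem W phi.
Proof.
elim: phi V W => [||p IHp q IHq|p IHp q IHq|b|h p IHp|v|a n y y_inj p IHp]
  V W VW //=.
- by rewrite (IHp V W) 1?(IHq V W) // => v fv; apply: VW; [right|left].
- by rewrite (IHp V W) 1?(IHq V W) // => v fv; apply: VW; [right|left].
- by rewrite (IHp V W).
- exact: VW.
have -> : (fun A i => sem (update V y A) (p i)) =
          (fun A i => sem (update W y A) (p i)); last by [].
apply/funext => A; apply/funext => i; apply: IHp => v fv; rewrite /update.
case: pickP => // nv; apply: VW; split; first by exists i.
by move=> j /eqP; rewrite nv.
Qed.

Lemma sat_sentence (T : set_functor) (L : modal_sig T) (Delta : choiceType)
    (C : coalg T) (x : C) (phi : form L Delta) (V : Delta -> set C) :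
  sentence phi -> sat x phi <-> sem V phi x.
Proof.
move=> phi0; rewrite /sat (@sem_free _ _ _ _ phi (fun _ => set0) V) // => v.
by rewrite phi0.
Qed.

Lemma shallow_nu_conjunctive (T : set_functor) (L : modal_sig T)
    (Delta : choiceType) (V : {fset Delta}) (n : nat) (x : 'I_n.+1 -> V)
    (x_bij : bijective x) (phi : 'I_n.+1 -> osform L V) :
  conjunctive (shallow_nu x_bij phi).
Proof. by split=> // i; elim: (phi i) => [|[h p|a] psi IH]. Qed.

Lemma shallow_nu_sentence (T : set_functor) (L : modal_sig T)
    (Delta : choiceType) (V : {fset Delta}) (n : nat) (x : 'I_n.+1 -> V)
    (x_bij : bijective x) (phi : 'I_n.+1 -> osform L V) :
  sentence (shallow_nu x_bij phi).
Proof.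
apply/seteqP; split=> // v [[i fv] nx].
have [p pv] : exists p : V, val p = v.
  elim: (phi i) fv => [//|[h p|a] psi IH] /= [vp|/IH//]; last by [].
  by exists p.
by have [g _ gK] := x_bij; apply: (nx (g p)); rewrite gK.
Qed.

(* Main.v *)
Require Import Defs.
From mathcomp Require Import all_boot.
From mathcomp Require Import finmap.
From mathcomp Require Import boolp classical_sets.

(** Satisfaction of [nu(x_0; ...).(phi_0; ...)] at [y] is witnessed by sets [B p]
    ([p] in V) such that every state in [B (x i)], seen as a one-step model with
    valuation [B], satisfies [phi i].  Such a [B] yields the simulation
    "[A] is related to [d] iff [d] lies in [B p] for all [p] in [A]", by the
    one-step wsi property of the model of [phi_A].  Conversely a simulation [S]
    yields [B p], the set of states simulating some [A] containing [p], since the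
    model of [phi_A] satisfies [phi_A] and [S] transfers its modal properties. *)

Set Implicit Arguments.
Unset Strict Implicit.
Unset Printing Implicit Defensive.

Local Open Scope classical_set_scope.

Lemma ossat_cat (T : set_functor) (L : modal_sig T) (V : Type)
    (N : osmodel T V) (psi chi : osform L V) :
  ossat N (psi ++ chi) <-> ossat N psi /\ ossat N chi.
Proof. by elim: psi => [|a psi IH] /=; tauto. Qed.

Lemma ossat_flatten (T : set_functor) (L : modal_sig T) (V : Type)
    (N : osmodel T V) (I : eqType) (psi : I -> osform L V) (s : seq I) :
  ossat N (flatten [seq psi i | i <- s]) <->
  forall i, i \in s -> ossat N (psi i).
Proof.
elim: s => [|j s IH] //=; rewrite ossat_cat IH; split.
  by case=> Nj Ns i; rewrite inE => /predU1P[->|/Ns].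
by move=> Ns; split=> [|i si]; apply: Ns; rewrite inE ?eqxx ?si ?orbT.
Qed.

Lemma ossat_phi_at (T : set_functor) (L : modal_sig T) (V : finType) (n : nat)
    (x : 'I_n.+1 -> V) (phi : 'I_n.+1 -> osform L V) (N : osmodel T V)
    (A : {set V}) :
  ossat N (phi_at x phi A) <-> forall i, x i \in A -> ossat N (phi i).
Proof.
rewrite /phi_at ossat_flatten; split=> [NA i Ai|NA i].
  by apply: NA; rewrite mem_filter Ai mem_enum.
by rewrite mem_filter => /andP[/NA].
Qed.

(** Only variables occurring in [psi] are compared, because [sw_valE] determines the valuation of a
    [set_os_wsi] on those alone. *)
Lemma ossat_transfer (T : set_functor) (L : modal_sig T) (V : finType)
    (N N' : osmodel T V) (psi : osform L V) :
  (forall (h : op1 L) p, p \in osvars psi ->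
     plift1 h (os_val N p) (os_elt N) -> plift1 h (os_val N' p) (os_elt N')) ->
  (forall a : op0 L, plift0 a _ (os_elt N) -> plift0 a _ (os_elt N')) ->
  ossat N psi -> ossat N' psi.
Proof.
move=> + H0; elim: psi => [//|[h p|a] psi IH] /= H1 [Na Npsi].
  split; first by apply: H1 Na; rewrite !inE eqxx.
  by apply: IH Npsi => k q qpsi; apply: H1; rewrite !inE qpsi orbT.
by split; [apply: H0|apply: IH].
Qed.

Lemma sem_form_of_os (T : set_functor) (L : modal_sig T) (Delta : choiceType)
    (V : {fset Delta}) (C : coalg T) (W : Delta -> set C) (psi : osform L V)
    (c : C) :
  sem W (form_of_os psi) c <->
  ossat (OSModel (fun p : V => W (val p)) (trans c)) psi.
Proof.
elim: psi => [//|a psi IH] /=.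
by split=> -[ca /IH cpsi]; split=> //; case: a ca.
Qed.

Lemma update_inj (Delta : choiceType) (X : Type) (W : Delta -> set X) (n : nat)
    (y : 'I_n -> Delta) (A : 'I_n -> set X) (i : 'I_n) :
  injective y -> update W y A (y i) = A i.
Proof.
move=> yI; rewrite /update; case: pickP => [j /eqP/yI->//|/(_ i)].
by rewrite eqxx.
Qed.

Lemma sat_shallow_nu (T : set_functor) (L : modal_sig T) (Delta : choiceType)
    (V : {fset Delta}) (n : nat) (x : 'I_n.+1 -> V) (x_bij : bijective x)
    (phi : 'I_n.+1 -> osform L V) (D : coalg T) (y : D) :
  sat y (shallow_nu x_bij phi) <->
  exists2 B : V -> set D,
    (forall i d, B (x i) d -> ossat (OSModel B (trans d)) (phi i)) &
    B (x ord0) y.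
Proof.
have xI := fset_enum_inj x_bij; have [g xK gK] := x_bij.
(* Each [p] in [V] equals [x (g p)], so the update overrides the default valuation on all of [V]:
   families indexed by ['I_n.+1] and by [V] correspond along [g]. *)
have updE (A : 'I_n.+1 -> set D) :
    (fun p : V => update (fun=> classical_sets.set0) (fun i => val (x i)) A (val p))
    = A \o g.
  by apply/funext => p; rewrite -{1}(gK p) (update_inj _ _ _ xI).
split=> [[A AF Ay]|[B BF By]].
  exists (A \o g); last by rewrite /= xK.
  by move=> i d; rewrite /= xK => /AF /sem_form_of_os; rewrite updE.
exists (B \o x) => // i d /BF Bd; apply/sem_form_of_os; rewrite updE.
by have -> : (B \o x) \o g = B by apply/funext => p /=; rewrite gK.
Qed.

Lemma transfers_mono (T : set_functor) (L : modal_sig T) (X Y : Type)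
    (R S : X -> Y -> Prop) (t : T X) (s : T Y) :
  (forall u v, R u v -> S u v) -> transfers L R t s -> transfers L S t s.
Proof.
move=> RS [H1 H0]; split=> // h A /H1; apply: plift1_mono => v [u Au /RS].
by exists u.
Qed.

(** By naturality [fmap T f t] satisfies [h] at [A] iff [t] does at the preimage of [A] under [f],
    whose image under the pulled-back relation lies in that of [A]. *)
Lemma transfers_fmap (T : set_functor) (L : modal_sig T) (X X' Y : Type)
    (f : X' -> X) (S : X -> Y -> Prop) (t : T X') (s : T Y) :
  transfers L (fun u v => S (f u) v) t s -> transfers L S (fmap T f t) s.
Proof.
case=> H1 H0; split=> [h A|a ta].
  rewrite -[plift1 h A _]/((fmap T f @^-1` plift1 h A) t) -plift1_nat => /H1.
  by apply: plift1_mono => v [u Au Suv]; exists (f u).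
by apply: H0; rewrite (plift0_nat a f).
Qed.

(* The valuation of a [set_os_wsi] may be larger than membership outside
   [osvars psi]; this only shrinks the relation of the one-step wsi property. *)
Lemma set_os_wsi_transfers (T : set_functor) (L : modal_sig T) (V : finType)
    (psi : osform L V) (M : set_os_wsi psi) (N : osmodel T V) :
  ossat N psi ->
  transfers L (fun (A : elems (sw_set M)) (d : os_carrier N) =>
                 forall p, p \in sval A -> os_val N p d)
            (sw_elt M) (os_elt N).
Proof.
move=> /(proj2 (sw_wsi M)); apply: transfers_mono => /= A d Ad p pA.
apply: Ad; rewrite /os_theory /= sw_valE //.
(* As [A] is a subset of [osvars psi], its element [p] occurs in [psi]. *)
have /fintype.subsetP/(_ _ (svalP A)) := sw_sub M.
by rewrite powersetE => /fintype.subsetP; apply.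
Qed.

Lemma canonical_simulation (T : set_functor) (L : modal_sig T)
    (M : forall (W : finType) (psi : osform L W), set_os_wsi psi)
    (V : finType) (n : nat) (x : 'I_n.+1 -> V) (phi : 'I_n.+1 -> osform L V)
    (D : coalg T) (B : V -> set D) :
  (forall i d, B (x i) d -> ossat (OSModel B (trans d)) (phi i)) ->
  simulation L (fun (A : canonical_model M x phi) d =>
                  forall p, p \in sval A -> B p d).
Proof.
move=> BF A d Ad; apply: transfers_fmap.
(* [Xphi_incl] keeps the underlying set, so the pulled-back relation is already the one of this
   lemma. *)
apply: (@set_os_wsi_transfers _ _ _ _ _ (OSModel B (trans d))).
by apply/ossat_phi_at => i xA; apply/BF/Ad.
Qed.

Lemma simulation_ossat (T : set_functor) (L : modal_sig T)
    (M : forall (W : finType) (psi : osform L W), set_os_wsi psi)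
    (V : finType) (n : nat) (x : 'I_n.+1 -> V) (phi : 'I_n.+1 -> osform L V)
    (D : coalg T) (S : canonical_model M x phi -> D -> Prop) :
  simulation L S ->
  let B (p : V) := rel_image S [set A : elems (Xphi M x phi) | p \in sval A] in
  forall i d, B (x i) d -> ossat (OSModel B (trans d)) (phi i).
Proof.
move=> Ssim B i d [A xA Ad].
(* Since [x i] lies in [A], it suffices to satisfy all of [phi_at A], which the chosen model
   does. *)
apply: (proj1 (ossat_phi_at x phi _ (sval A)) _ i xA).
have [H1 H0] := Ssim _ _ Ad.
apply: ossat_transfer (proj1 (sw_wsi (M _ (phi_at x phi (sval A))))) => /=.
  move=> h p pA tp; apply: H1.
  (* The preimage under [Xphi_incl] of the states containing [p] is [sw_val p]. *)
  rewrite /= -[plift1 h _ _]/((fmap T _ @^-1` plift1 h _) _) -plift1_nat.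
  by rewrite sw_valE // in tp.
move=> a; rewrite (plift0_nat a (@Xphi_incl _ _ M _ _ x phi A)).
exact: H0.
Qed.

Theorem theorem6p5 (T : set_functor) (T_nontrivial : nontrivial T)
    (T_subsets : preserves_subsets T) (L : modal_sig T)
    (L_admits : admits_os_wsi L)
    (M : forall (W : finType) (psi : osform L W), set_os_wsi psi)
    (Delta : choiceType) (V : {fset Delta}) (n : nat)
    (x : 'I_n.+1 -> V) (x_bij : bijective x)
    (phi : 'I_n.+1 -> osform L V) :
  wsi (shallow_nu x_bij phi) (canonical_model M x phi) (canonical_root M x phi).
Proof.
move=> D y; rewrite sat_shallow_nu; split=> [[B BF By]|[S Ssim Sy]].
  exists (fun (A : canonical_model M x phi) d => forall p, p \in sval A -> B p d).
    exact: canonical_simulation.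
  (* The only element of the root is [x ord0]. *)
  by move=> p /finset.set1P->.
exists (fun p : V => rel_image S [set A : elems (Xphi M x phi) | p \in sval A]).
  exact: simulation_ossat.
by exists (canonical_root M x phi) => //; apply/finset.set1P.
Qed.
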